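(* The semantic input membership problem is undecidable. This is the problem: given a variable $x$ and a LIF expression $\alpha$, decide whether $x\in I^{\mathrm{sem}}(\alpha)$.
   Context: **Basic setting.** A vocabulary $\mathcal S$ is a nonempty set of module names, each module name $M$ having an arity $ar(M)$ and an input arity $iar(M)\le ar(M)$ (natural numbers). Fix a countably infinite set $\mathbf{dom}$. An interpretation $D$ of $\mathcal S$ assigns to each module name $M$ an $ar(M)$-ary relation $D(M)$ over $\mathbf{dom}$. Fix a set $\mathbb V$ of variables, which may be finite or infinite. A valuation is a function $\mathbb V\to\mathbf{dom}$; $\mathcal V$ is the set of all valuations. Valuations agree on $Y\subseteq\mathbb V$ if they have equal values on every $y\in Y$; they agree outside $Y$ if they agree on $\mathbb V- Y$. A BRV is a subset of $\mathcal V\times\mathcal V$; a global BRV is a function $Q$ mapping each interpretation $D$ to a BRV $Q(D)$. **Operations on BRVs** $A,B$ ($Z$ a finite set of variables; $x,y$ variables): union, intersection, set difference $A-B$; composition $A;B=\{(\nu_1,\nu_2)\mid\exists\nu_3:(\nu_1,\nu_3)\in A,(\nu_3,\nu_2)\in B\}$; converse $A^{-1}=\{(\nu_1,\nu_2)\mid(\nu_2,\nu_1)\in A\}$; left cylindrification $\mathrm{cyl}^l_Z(A)=\{(\nu_1,\nu_2)\mid\exists\nu_1':(\nu_1',\nu_2)\in A,\ \nu_1'\text{ and }\nu_1\text{ agree outside }Z\}$; right cylindrification $\mathrm{cyl}^r_Z(A)=\{(\nu_1,\nu_2)\mid\exists\nu_2':(\nu_1,\nu_2')\in A,\ \nu_2'\text{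 and }\nu_2\text{ agree outside }Z\}$; selections $\sigma^l_{x=y}(A)=\{(\nu_1,\nu_2)\in A\mid\nu_1(x)=\nu_1(y)\}$, $\sigma^r_{x=y}(A)=\{(\nu_1,\nu_2)\in A\mid\nu_2(x)=\nu_2(y)\}$, $\sigma^{lr}_{x=y}(A)=\{(\nu_1,\nu_2)\in A\mid\nu_1(x)=\nu_2(y)\}$. **LIF expressions** over a vocabulary $\mathcal S$ are generated by $\alpha::=\mathit{id}\mid M(\bar x;\bar y)\mid\alpha\cup\alpha\mid\alpha\cap\alpha\mid\alpha-\alpha\mid\alpha;\alpha\mid\alpha^{-1}\mid\mathrm{cyl}^l_Z(\alpha)\mid\mathrm{cyl}^r_Z(\alpha)\mid\sigma^{lr}_{x=y}(\alpha)\mid\sigma^l_{x=y}(\alpha)\mid\sigma^r_{x=y}(\alpha)$, where $M$ is a module name of $\mathcal S$ and in an atomic module expression $M(\bar x;\bar y)$ the tuples of variables $\bar x,\bar y$ have lengths $iar(M)$ and $ar(M)-iar(M)$. Semantics: $[\![\mathit{id}]\!]_D=\{(\nu,\nu)\mid\nu\in\mathcal V\}$; $[\![M(\bar x;\bar y)]\!]_D=\{(\nu_1,\nu_2)\mid\nu_1(\bar x)\cdot\nu_2(\bar y)\in D(M)\text{ and }\nu_1,\nu_2\text{ agree outside }\bar y\}$ ($\cdot$ is concatenation of tuples); the other operators are interpreted by the corresponding BRV operations. $[\![\alpha]\!]$ denotes the global BRV $D\mapsto[\![\alpha]\!]_D$. **Semantic outputs and inputs.** $O^{\mathrm{sem}}(\alpha)$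 is the set of variables $x$ for which there are an interpretation $D$ and $(\nu_1,\nu_2)\in[\![\alpha]\!]_D$ with $\nu_1(x)\ne\nu_2(x)$. For a global BRV $Q$ and $X,Y\subseteq\mathbb V$, $X$ determines $Q$ on $Y$ if for every interpretation $D$, every $(\nu_1,\nu_2)\in Q(D)$ and every valuation $\nu_1'$ agreeing with $\nu_1$ on $X$, there is $\nu_2'$ agreeing with $\nu_2$ on $Y$ such that $(\nu_1',\nu_2')\in Q(D)$. $I^{\mathrm{sem}}(\alpha)$ is the set of variables $x$ such that $\mathbb V-\{x\}$ does not determine $[\![\alpha]\!]$ on $O^{\mathrm{sem}}(\alpha)$. *)

(* Defs.v *)
From mathcomp Require Import finmap.
From mathcomp Require Import all_boot.

Set Implicit Arguments.
Unset Strict Implicit.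
Unset Printing Implicit Defensive.

Record vocabulary := Vocabulary {
  mname : Type;
  ar : mname -> nat;
  iar : mname -> nat;
  iar_le : forall M, iar M <= ar M;
  mname_inh : inhabited mname }.

Definition interpretation (S : vocabulary) (dom : Type) :=
  forall M : mname S, (ar M).-tuple dom -> Prop.

Definition valuation (V dom : Type) := V -> dom.

Definition agree_on (V dom : Type) (Y : V -> Prop) (nu1 nu2 : valuation V dom) :=
  forall y, Y y -> nu1 y = nu2 y.

Definition agree_outside (V dom : Type) (Y : V -> Prop) :=
  @agree_on V dom (fun y => ~ Y y).

Definition brv (V dom : Type) := valuation V dom -> valuation V dom -> Prop.

Definition global_brv (S : vocabulary) (V dom : Type) :=
  interpretation S dom -> brv V dom.

Section BRVOperations.
Context {V : choiceType} {dom : Type}.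
Implicit Types (A B : brv V dom) (Z : {fset V}) (x y : V).

Definition brv_id : brv V dom := fun nu1 nu2 => nu1 = nu2.
Definition brv_cup A B : brv V dom := fun nu1 nu2 => A nu1 nu2 \/ B nu1 nu2.
Definition brv_cap A B : brv V dom := fun nu1 nu2 => A nu1 nu2 /\ B nu1 nu2.
Definition brv_diff A B : brv V dom := fun nu1 nu2 => A nu1 nu2 /\ ~ B nu1 nu2.
Definition brv_comp A B : brv V dom :=
  fun nu1 nu2 => exists nu3, A nu1 nu3 /\ B nu3 nu2.
Definition brv_conv A : brv V dom := fun nu1 nu2 => A nu2 nu1.
Definition brv_cyll Z A : brv V dom := fun nu1 nu2 =>
  exists nu1', A nu1' nu2 /\ agree_outside (fun z => z \in Z) nu1' nu1.
Definition brv_cylr Z A : brv V dom := fun nu1 nu2 =>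
  exists nu2', A nu1 nu2' /\ agree_outside (fun z => z \in Z) nu2' nu2.
Definition brv_sell x y A : brv V dom :=
  fun nu1 nu2 => A nu1 nu2 /\ nu1 x = nu1 y.
Definition brv_selr x y A : brv V dom :=
  fun nu1 nu2 => A nu1 nu2 /\ nu2 x = nu2 y.
Definition brv_sellr x y A : brv V dom :=
  fun nu1 nu2 => A nu1 nu2 /\ nu1 x = nu2 y.

End BRVOperations.

Inductive lif (S : vocabulary) (V : choiceType) : Type :=
| LId
| LMod (M : mname S) (xs : (iar M).-tuple V) (ys : (ar M - iar M).-tuple V)
| LCup (a b : lif S V)
| LCap (a b : lif S V)
| LDiff (a b : lif S V)
| LComp (a b : lif S V)
| LConv (a : lif S V)
| LCylL (Z : {fset V}) (a : lif S V)
| LCylR (Z : {fset V}) (a : lif S V)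
| LSelLR (x y : V) (a : lif S V)
| LSelL (x y : V) (a : lif S V)
| LSelR (x y : V) (a : lif S V).

(* The cast identifies iar M + (ar M - iar M) with ar M.                      *)
Definition brv_mod (S : vocabulary) (V : choiceType) (dom : Type)
    (D : interpretation S dom) (M : mname S)
    (xs : (iar M).-tuple V) (ys : (ar M - iar M).-tuple V) : brv V dom :=
  fun nu1 nu2 =>
    D M (tcast (subnKC (iar_le M)) [tuple of map nu1 xs ++ map nu2 ys]) /\
    agree_outside (fun z => z \in ys) nu1 nu2.

Fixpoint sem (S : vocabulary) (V : choiceType) (dom : Type)
    (a : lif S V) (D : interpretation S dom) {struct a} : brv V dom :=
  match a with
  | LId => brv_id
  | LMod M xs ys => brv_mod D xs ys
  | LCup a b => brv_cup (sem a D) (sem b D)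
  | LCap a b => brv_cap (sem a D) (sem b D)
  | LDiff a b => brv_diff (sem a D) (sem b D)
  | LComp a b => brv_comp (sem a D) (sem b D)
  | LConv a => brv_conv (sem a D)
  | LCylL Z a => brv_cyll Z (sem a D)
  | LCylR Z a => brv_cylr Z (sem a D)
  | LSelLR x y a => brv_sellr x y (sem a D)
  | LSelL x y a => brv_sell x y (sem a D)
  | LSelR x y a => brv_selr x y (sem a D)
  end.

Definition sem_outputs (S : vocabulary) (V : choiceType) (dom : Type)
    (a : lif S V) (x : V) : Prop :=
  exists (D : interpretation S dom) (nu1 nu2 : valuation V dom),
    sem a D nu1 nu2 /\ nu1 x <> nu2 x.

Definition determines (S : vocabulary) (V dom : Type)
    (X : V -> Prop) (Q : global_brv S V dom) (Y : V -> Prop) : Prop :=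
  forall (D : interpretation S dom) (nu1 nu2 nu1' : valuation V dom),
    Q D nu1 nu2 -> agree_on X nu1' nu1 ->
    exists nu2' : valuation V dom, agree_on Y nu2' nu2 /\ Q D nu1' nu2'.

Definition sem_inputs (S : vocabulary) (V : choiceType) (dom : Type)
    (a : lif S V) (x : V) : Prop :=
  ~ determines (fun y => y <> x) (sem (dom := dom) a) (sem_outputs dom a).

(* Kleene's partial recursive functions; [murec k] are descriptions of        *)
(* partial functions of k arguments.                                          *)
Inductive murec : nat -> Type :=
| MZero k : murec k
| MSucc : murec 1
| MProj k (i : 'I_k) : murec k
| MComp k m (f : murec m) (g : 'I_m -> murec k) : murec k
| MPrec k (f : murec k) (g : murec k.+2) : murec k.+1
| MMin k (f : murec k.+1) : murec k.

(* [mu_eval f v r]: the function described by f is defined at v, with value r.*)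
(* For primitive recursion s lists the successive values; the recursion       *)
(* variable comes first.  Minimization also searches for the first argument,  *)
(* and requires all smaller tries to be defined and nonzero.                  *)
Fixpoint mu_eval k (f : murec k) : k.-tuple nat -> nat -> Prop :=
  match f in murec k return k.-tuple nat -> nat -> Prop with
  | MZero _ => fun _ r => r = 0
  | MSucc => fun v r => r = (thead v).+1
  | MProj _ i => fun v r => r = tnth v i
  | MComp _ m f g => fun v r => exists w : m.-tuple nat,
      (forall i, mu_eval (g i) v (tnth w i)) /\ mu_eval f w r
  | MPrec _ f g => fun v r => exists s : nat -> nat,
      [/\ mu_eval f [tuple of behead v] (s 0),
          (forall n, n < thead v ->
             mu_eval g [tuple of n :: s n :: behead v] (s n.+1))
        & r = s (thead v)]
  | MMin _ f => fun v r => mu_eval f [tuple of r :: v] 0 /\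
      (forall n, n < r -> exists t, mu_eval f [tuple of n :: v] t.+1)
  end.

Lemma mu_eval_det k (f : murec k) v r r' : mu_eval f v r -> mu_eval f v r' -> r = r'.
Proof.
elim: f v r r' => {k} [k||k i|k m f IHf g IHg|k f IHf g IHg|k f IHf] v r r' /=; try by move=> -> ->.
- move=> [w [H1 H2]] [w' [H1' H2']].
  have E : w = w' by apply: eq_from_tnth => i; apply: IHg (H1 i) (H1' i).
  by subst; apply: IHf H2 H2'.
- move=> [s [a b ->]] [t [a' b' ->]].
  have H : forall n, n <= thead v -> s n = t n.
    elim=> [_|n IH ln]; first exact: IHf a a'.
    have := b n ln; have := b' n ln; rewrite IH; last exact: ltnW.
    by move=> h1 h2; apply: IHg h2 h1.
  exact: H.
- move=> [a b] [a' b']; case: (ltngtP r r') => // h.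
    by have [t ht] := b' _ h; have := IHf _ _ _ a ht.
  by have [t ht] := b _ h; have := IHf _ _ _ a' ht.
Qed.

(* A decision problem is a predicate on a type of instances, each given to    *)
(* the machine through its code; nothing is required of a decision procedure  *)
(* on numbers that are not codes of instances.                                *)
Definition decidable_problem (I : Type) (code : I -> nat) (P : I -> Prop) :=
  exists c : murec 1, forall i,
    (P i -> mu_eval c [tuple code i] 1) /\ (~ P i -> mu_eval c [tuple code i] 0).

Definition undecidable_problem (I : Type) (code : I -> nat) (P : I -> Prop) :=
  ~ decidable_problem code P.

(* A finite vocabulary as a finite object: the sequence of the pairs          *)
(* (arity, input arity), the module names being the positions.                *)
Record fin_voc := FinVoc {
  fv_seq :> seq (nat * nat);
  fv_nonempty : 0 < size fv_seq;
  fv_le : all (fun p => p.2 <= p.1) fv_seq }.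

Lemma fv_iar_le (F : fin_voc) (i : 'I_(size F)) :
  (tnth (in_tuple F) i).2 <= (tnth (in_tuple F) i).1.
Proof. exact: (allP (fv_le F)) (mem_tnth i (in_tuple F)). Qed.

Definition voc_of_fin (F : fin_voc) : vocabulary :=
  {| mname := 'I_(size F);
     ar := fun i => (tnth (in_tuple F) i).1;
     iar := fun i => (tnth (in_tuple F) i).2;
     iar_le := @fv_iar_le F;
     mname_inh := inhabits (Ordinal (fv_nonempty F)) |}.

Definition fv_code (F : fin_voc) : nat :=
  CodeSeq.code [seq CodeSeq.code [:: p.1; p.2] | p <- F].

Definition vars_code (V : countType) (s : seq V) : nat :=
  CodeSeq.code (map pickle s).

(* [CodeSeq.code] is MathComp's (effective) bijection from seq nat to nat;    *)
(* each node is coded by the sequence of a constructor tag and its arguments. *)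
Fixpoint lif_code (F : fin_voc) (V : countType)
    (a : lif (voc_of_fin F) V) : nat :=
  match a with
  | LId => CodeSeq.code [:: 0]
  | LMod M xs ys =>
      CodeSeq.code [:: 1; (M : 'I_(size F)) : nat; vars_code xs; vars_code ys]
  | LCup a b => CodeSeq.code [:: 2; lif_code a; lif_code b]
  | LCap a b => CodeSeq.code [:: 3; lif_code a; lif_code b]
  | LDiff a b => CodeSeq.code [:: 4; lif_code a; lif_code b]
  | LComp a b => CodeSeq.code [:: 5; lif_code a; lif_code b]
  | LConv a => CodeSeq.code [:: 6; lif_code a]
  | LCylL Z a => CodeSeq.code [:: 7; vars_code (enum_fset Z); lif_code a]
  | LCylR Z a => CodeSeq.code [:: 8; vars_code (enum_fset Z); lif_code a]
  | LSelLR x y a => CodeSeq.code [:: 9; pickle x; pickle y; lif_code a]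
  | LSelL x y a => CodeSeq.code [:: 10; pickle x; pickle y; lif_code a]
  | LSelR x y a => CodeSeq.code [:: 11; pickle x; pickle y; lif_code a]
  end.

(* The vocabulary of the expression is part of the input.                     *)
Record membership_instance (V : countType) := MembershipInstance {
  mi_voc : fin_voc;
  mi_var : V;
  mi_expr : lif (voc_of_fin mi_voc) V }.

Definition mi_code (V : countType) (i : membership_instance V) : nat :=
  CodeSeq.code [:: fv_code (mi_voc i); pickle (mi_var i); lif_code (mi_expr i)].

Lemma seq_code_inj : injective CodeSeq.code.
Proof. exact: can_inj CodeSeq.codeK. Qed.
Lemma vars_code_inj (V : countType) : injective (@vars_code V).
Proof. by move=> s t /seq_code_inj /(inj_map (pcan_inj choice.pickleK)). Qed.
Lemma lif_code_inj (F : fin_voc) (V : countType) : injective (@lif_code F V).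
Proof.
elim=> [|M xs ys|a IHa b IHb|a IHa b IHb|a IHa b IHb|a IHa b IHb|a IHa|Z a IHa|Z a IHa|x y a IHa|x y a IHa|x y a IHa]
  [|M' xs' ys'|a' b'|a' b'|a' b'|a' b'|a'|Z' a'|Z' a'|x' y' a'|x' y' a'|x' y' a'] // H; move: (seq_code_inj H) => //; clear H.
- case=> /ord_inj E. move: E xs' ys' => <- xs' ys' /vars_code_inj /val_inj -> /vars_code_inj /val_inj -> //.
- by case=> /IHa -> /IHb ->.
- by case=> /IHa -> /IHb ->.
- by case=> /IHa -> /IHb ->.
- by case=> /IHa -> /IHb ->.
- by case=> /IHa ->.
- by case=> /vars_code_inj /val_inj -> /IHa ->.
- by case=> /vars_code_inj /val_inj -> /IHa ->.
- by case=> /(pcan_inj choice.pickleK) -> /(pcan_inj choice.pickleK) -> /IHa ->.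
- by case=> /(pcan_inj choice.pickleK) -> /(pcan_inj choice.pickleK) -> /IHa ->.
- by case=> /(pcan_inj choice.pickleK) -> /(pcan_inj choice.pickleK) -> /IHa ->.
Qed.
Lemma fv_code_inj : injective fv_code.
Proof.
move=> [s n l] [t n' l'] H; move: (seq_code_inj H); clear H => /inj_map E.
have {E} E : s = t by apply: E => -[a b] [c d] H; case: (seq_code_inj H) => -> ->.
by subst t; rewrite (bool_irrelevance n n') (bool_irrelevance l l').
Qed.
Lemma mi_code_inj (V : countType) : injective (@mi_code V).
Proof.
move=> [F x a] [G y b] H; move: (seq_code_inj H); clear H => -[/fv_code_inj E]; subst G.
by move=> /(pcan_inj choice.pickleK) -> /lif_code_inj ->.
Qed.


Definition sem_input_membership (dom : Type) (V : countType)
    (i : membership_instance V) : Prop :=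
  sem_inputs dom (mi_expr i) (mi_var i).

(* Main.v *)
From Stdlib Require Import Setoid Classical FunctionalExtensionality.
From Stdlib Require Import PropExtensionality.
Require Import Defs.
From mathcomp Require Import finmap.
From mathcomp Require Import all_boot.
From mathcomp Require Import zify.

(* With the single variable x0, LIF is the calculus of binary relations on dom.
   Over four binary symbols (an order L, projections P and Q, a sequence lookup
   E) and finitely many axioms holding in the natural numbers, every recursive
   function f is translated to a relational term that contains the graph of f
   in the standard model and that, in every model of the axioms, sends a code
   of an argument v with f(v) = r to nothing but the numeral r.  Hence there is
   an expression, a composition of a term depending on f with one depending on
   n, whose semantics is empty in all interpretations if f(n) = 1, and whose
   domain is a proper nonempty subset of dom in some interpretation if
   f(n) = 0; so x0 is an input in the second case only.  If c decided
   membership, let f(n) be c applied to the code of the expression whose first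
   factor has code n and whose second factor is the one for n.  At the code n of
   the first factor of f itself, c then answers wrongly.  No interpretation of
   codes is needed to compute f: codes of factors are only plugged into
   CodeSeq.code. *)

Set Implicit Arguments.
Unset Strict Implicit.
Unset Printing Implicit Defensive.

(** * Relational terms and their embedding into LIF over one variable *)

Inductive rel_term (A : Type) : Type :=
| Sym (a : A)
| Id
| Top
| Cup (s t : rel_term A)
| Cap (s t : rel_term A)
| Diff (s t : rel_term A)
| Comp (s t : rel_term A)
| Conv (t : rel_term A).

Arguments Id {A}.
Arguments Top {A}.

Fixpoint rel_sem (A dom : Type) (I : A -> dom -> dom -> Prop) (t : rel_term A) :
    dom -> dom -> Prop :=
  match t with
  | Sym a => I a
  | Id => fun x y => x = y
  | Top => fun _ _ => True
  | Cup s t => fun x y => rel_sem I s x y \/ rel_sem I t x y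
  | Cap s t => fun x y => rel_sem I s x y /\ rel_sem I t x y
  | Diff s t => fun x y => rel_sem I s x y /\ ~ rel_sem I t x y
  | Comp s t => fun x y => exists z, rel_sem I s x z /\ rel_sem I t z y
  | Conv t => fun x y => rel_sem I t y x
  end.

(** Carries the standard model from [nat] over to [dom] along a bijection. *)
Lemma rel_sem_transport (A dom dom' : Type) (I : A -> dom -> dom -> Prop)
    (h : dom -> dom') (h' : dom' -> dom) (hK : cancel h h') (h'K : cancel h' h)
    (t : rel_term A) x y :
  rel_sem (fun a x y => I a (h' x) (h' y)) t x y <-> rel_sem I t (h' x) (h' y).
Proof.
elim: t x y => [a|||s IHs t IHt|s IHs t IHt|s IHs t IHt|s IHs t IHt|t IHt] x y //=.
- by split=> [->|/(can_inj h'K)].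
- by move: (IHs x y) (IHt x y); tauto.
- by move: (IHs x y) (IHt x y); tauto.
- by move: (IHs x y) (IHt x y); tauto.
- split=> [[z [/IHs Hs /IHt Ht]]|[z [Hs Ht]]]; first by exists (h' z).
  by exists (h z); split; [apply/IHs|apply/IHt]; rewrite hK.
Qed.

Section SingleVariable.
Variables (S : vocabulary) (V : choiceType) (dom : Type) (x0 : V).

(** Every image relates only valuations that agree off [x0]. Cylindrifying the identity at [x0]
    gives the largest such relation, so it can serve as [Top]. *)
Fixpoint lif_of (t : rel_term (mname S)) : lif S V :=
  match t with
  | Sym M => LMod (nseq_tuple (iar M) x0) (nseq_tuple (ar M - iar M) x0)
  | Id => LId S V
  | Top => LCylL [fset x0]%fset (LId S V)
  | Cup s t => LCup (lif_of s) (lif_of t)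
  | Cap s t => LCap (lif_of s) (lif_of t)
  | Diff s t => LDiff (lif_of s) (lif_of t)
  | Comp s t => LComp (lif_of s) (lif_of t)
  | Conv t => LConv (lif_of t)
  end.

Definition diag_interp (D : interpretation S dom) (M : mname S) (a b : dom) :=
  D M (tcast (subnKC (iar_le M))
    [tuple of nseq (iar M) a ++ nseq (ar M - iar M) b]).

(** By [output_arity], [x0] occurs among the outputs of every atomic expression, which therefore
    constrains the two values of [x0] through [D] alone. In a composition the intermediate valuation
    is [nu1] updated at [x0]. *)
Lemma sem_lif_of (t : rel_term (mname S)) (D : interpretation S dom)
    (nu1 nu2 : valuation V dom)
    (output_arity : forall M : mname S, iar M < ar M) :
  sem (lif_of t) D nu1 nu2 <->
  agree_on (fun y => y <> x0) nu1 nu2 /\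
  rel_sem (diag_interp D) t (nu1 x0) (nu2 x0).
Proof.
elim: t nu1 nu2 => [M|||s IHs t IHt|s IHs t IHt|s IHs t IHt|s IHs t IHt|t IHt] nu1 nu2 /=.
- rewrite /brv_mod /diag_interp.
  have -> : [tuple of map nu1 (nseq_tuple (iar M) x0) ++
                      map nu2 (nseq_tuple (ar M - iar M) x0)]
    = [tuple of nseq (iar M) (nu1 x0) ++ nseq (ar M - iar M) (nu2 x0)].
    by apply: val_inj; rewrite /= !map_nseq.
  split=> [[H1 H2]|[H1 H2]]; split=> // y Hy.
    by apply: (H2 y); rewrite mem_nseq => /andP[_ /eqP].
  by apply: (H1 y) => E; apply: Hy; rewrite mem_nseq subn_gt0 output_arity /= E.
- split=> [->//|[H1 H2]]; apply: functional_extensionality => y.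
  by case: (eqVneq y x0) => [->//|/eqP]; apply: H1.
- split=> [[nu [-> H]]|[H _]].
    by split=> // y Hy; rewrite (H y) // => /fset1P.
  exists nu2; split=> // y Hy; rewrite H // => E; apply: Hy; rewrite E.
  exact/fset1P.
- by move: (IHs nu1 nu2) (IHt nu1 nu2); rewrite /brv_cup; tauto.
- by move: (IHs nu1 nu2) (IHt nu1 nu2); rewrite /brv_cap; tauto.
- by move: (IHs nu1 nu2) (IHt nu1 nu2); rewrite /brv_diff; tauto.
- split=> [[nu [/IHs[H1 H2] /IHt[H3 H4]]]|[H [z [Hs Ht]]]].
    by split; [move=> y Hy; rewrite H1 // H3|exists (nu x0)].
  exists (fun y => if y == x0 then z else nu1 y).
  split; [apply/IHs|apply/IHt]; rewrite eqxx; split=> // y /eqP Hy;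
    rewrite (negPf Hy) //; apply: H; exact/eqP.
- by split=> [/IHt[H1 H2]|[H1 H2]]; [|apply/IHt]; split=> // y Hy; rewrite H1.
Qed.

End SingleVariable.

(** * The axioms and the translation of recursive functions into terms *)

Definition symL : 'I_4 := @Ordinal 4 0 isT.
Definition symP : 'I_4 := @Ordinal 4 1 isT.
Definition symQ : 'I_4 := @Ordinal 4 2 isT.
Definition symE : 'I_4 := @Ordinal 4 3 isT.

Notation tL := (Sym symL).
Notation tP := (Sym symP).
Notation tQ := (Sym symQ).
Notation tE := (Sym symE).

Definition tS : rel_term 'I_4 := Diff tL (Comp tL tL).
(** The identity on elements without immediate predecessor. A model has at most one of these; no
    axiom asserts that there is one. *)
Definition tzero : rel_term 'I_4 := Diff Id (Comp Top tS).

(* [tS] stands for the immediate successor in the order [L]; [P] and [Q] are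
   partial functions; [E] is functional in the pair of projections of its
   argument, which need not determine that argument. *)
Definition axioms : seq (rel_term 'I_4 * rel_term 'I_4) :=
  [:: (tL, Comp (Cup Id tL) tS);
      (Comp tL tS, tL);
      (Top, Cup Id (Cup tL (Conv tL)));
      (Id, Comp tS Top);
      (Comp (Conv tP) tP, Id);
      (Comp (Conv tQ) tQ, Id);
      (Comp (Conv tE)
            (Comp (Cap (Comp tP (Conv tP)) (Comp tQ (Conv tQ))) tE), Id)].

Definition models (dom : Type) (I : 'I_4 -> dom -> dom -> Prop) :=
  forall p, List.In p axioms ->
  forall a b, rel_sem I p.1 a b -> rel_sem I p.2 a b.

Definition violation : rel_term 'I_4 :=
  foldr (fun p t => Cup (Diff p.1 p.2) t) (Diff Id Id) axioms.

Lemma violationP (dom : Type) (I : 'I_4 -> dom -> dom -> Prop) :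
  models I <-> ~ exists a b, rel_sem I violation a b.
Proof.
rewrite /models /violation; elim: axioms => [|p s IH] /=.
  by split=> // _ [a [b []]].
split=> [H [a [b [[H1 H2]|H1]]]|H q [<-|Hq] a b Ha].
- by apply: H2; apply: H => //; left.
- by case/IH: (fun q Hq => H q (or_intror Hq)); exists a, b.
- by apply: NNPP => Hb; apply: H; exists a, b; left.
- apply: ((proj2 IH) _ q) => // -[a' [b' H']].
  by apply: H; exists a', b'; right.
Qed.

(* Lists are nested pairs, with head [P] and tail [Q]. *)
Definition tproj (i : nat) : rel_term 'I_4 := iter i (Comp tQ) tP.

(* Relates [c] to those [n] such that an element with [P]-image [n] and
   [Q]-image [c] lies in the domain of [t]. *)
Definition tsection (t : rel_term 'I_4) : rel_term 'I_4 :=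
  Comp (Conv tQ) (Cap tP (Comp t Top)).

(* If [s] and [t] are functions, this maps [x] to entry [t x] of the sequence
   coded by [s x]. *)
Definition tentry (s t : rel_term 'I_4) : rel_term 'I_4 :=
  Comp (Cap (Comp s (Conv tP)) (Comp t (Conv tQ))) tE.

(* Acts on [h = <m, <s, <n, w>>>]: the step function, of graph [g], sends
   [(m, s_m, w)] to [s_(m+1)]. *)
Definition tstep (g : rel_term 'I_4) : rel_term 'I_4 :=
  Cap (Comp (Cap (Comp tP (Conv tP))
            (Cap (Comp (tentry (Comp tQ tP) tP) (Conv (Comp tQ tP)))
                 (Comp (Comp tQ (Comp tQ tQ)) (Conv (Comp tQ tQ))))) g)
      (tentry (Comp tQ tP) (Comp tP tS)).

Arguments tS : simpl never.
Arguments tzero : simpl never.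
Arguments tsection : simpl never.
Arguments tentry : simpl never.
Arguments tstep : simpl never.

(** For primitive recursion, [Conv tQ] guesses a sequence and puts it before the argument list; the
    value is its entry at the recursion variable, and its entry at zero must be a value of [f].
    Bounded universal conditions, here and for minimization, exclude by [Diff] the existence of a
    smaller element outside a section. *)
Fixpoint graph_term k (f : murec k) : rel_term 'I_4 :=
  match f with
  | MZero _ => Comp Top tzero
  | MSucc => Comp tP tS
  | MProj _ i => tproj i
  | MComp _ m f g =>
      Comp (foldr (fun i t => Cap (Comp (graph_term (g i)) (Conv (tproj i))) t)
                  Top (enum 'I_m))
           (graph_term f)
  | MPrec _ f g =>
      Comp (Conv tQ)
        (Diff (Cap (tentry tP (Comp tQ tP))
                   (Comp (Cap (Comp (Comp tQ tQ) (graph_term f))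
                              (tentry tP (Comp Top tzero))) Top))
              (Comp (Cap (Comp (Diff Top (tsection (tstep (graph_term g)))) tL)
                         (Comp tQ tP)) Top))
  | MMin _ f =>
      Diff (tsection (Comp (graph_term f) tzero))
           (Comp (Diff Top (tsection (Comp (graph_term f) (Conv tS)))) tL)
  end.

Lemma rel_sem_foldr_cap (A dom : Type) (I : A -> dom -> dom -> Prop) (T : finType)
    (F : T -> rel_term A) a b :
  rel_sem I (foldr (fun i t => Cap (F i) t) Top (enum T)) a b <->
  forall i, rel_sem I (F i) a b.
Proof.
transitivity (forall i, i \in enum T -> rel_sem I (F i) a b); last first.
  by split=> H i; [apply: H; rewrite mem_enum|].
elim: (enum T) => [|j s IH] //=; split=> [[H1 /IH H2] i|H].
  by rewrite inE => /predU1P[->|/H2].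
by split; [|apply/IH => i Hi]; apply: H; rewrite inE ?eqxx // Hi orbT.
Qed.

(** * The standard model *)

(** Every number codes a list. [E] reads the head as the code of a sequence and the coded tail as an
    index, so its value depends only on the two projections, as the last axiom requires. *)
Definition standard (i : 'I_4) (a b : nat) : Prop :=
  match val i with
  | 0 => a < b
  | 1 => b = head 0 (CodeSeq.decode a)
  | 2 => b = CodeSeq.code (behead (CodeSeq.decode a))
  | _ => b = nth 0 (CodeSeq.decode (head 0 (CodeSeq.decode a)))
                   (CodeSeq.code (behead (CodeSeq.decode a)))
  end.

Lemma standard_succ a b : rel_sem standard tS a b <-> b = a.+1.
Proof.
rewrite /tS /= /standard /=; split=> [[H1 H2]|->].
  case: (ltngtP b a.+1) => //; first by lia.
  by move=> H; case: H2; exists a.+1.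
by split=> // -[c]; lia.
Qed.

Lemma standard_zero a b : rel_sem standard tzero a b <-> a = 0 /\ b = 0.
Proof.
split=> [[<- H]|[-> ->]].
  by case: a H => // a [] /=; exists a; split=> //; apply/standard_succ.
by split=> // -[c [_ /standard_succ]].
Qed.

Lemma standard_models : models standard.
Proof.
move=> p /=; do 7?[case=> [<-|]] => // a b.
- case: b => [//|b]; rewrite [X in X -> _]/= {1}/standard /= => H.
  exists b; split; last exact/standard_succ.
  by move: H; rewrite ltnS leq_eqVlt => /orP[/eqP->|H]; [left|right].
- by case=> c [+ /standard_succ ->]; rewrite /= /standard /=; lia.
- by rewrite /= /standard /=; case: (ltngtP a b) => H; auto.
- by move=> _; exists a.+1; split=> //; apply/standard_succ.
- by case=> c [/=]; rewrite /standard /= => -> ->.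
- by case=> c [/=]; rewrite /standard /= => -> ->.
- case=> c [/=]; rewrite /standard /= => -> [d [[[x [H1 H2]] [y [H3 H4]]]]] ->.
  by rewrite -H1 -H3 H2 H4.
Qed.

(** Serves both as pairing and as list extension, since every [b] codes a list. *)
Definition cons_code a b := CodeSeq.code (a :: CodeSeq.decode b).
Lemma standardP_cons a b : standard symP (cons_code a b) a.
Proof. by rewrite /standard /= CodeSeq.codeK. Qed.
Lemma standardQ_cons a b : standard symQ (cons_code a b) b.
Proof. by rewrite /standard /= CodeSeq.codeK /= CodeSeq.decodeK. Qed.

Lemma standardE_cons a b : standard symE (cons_code a b) (nth 0 (CodeSeq.decode a) b).
Proof. by rewrite /standard /= CodeSeq.codeK /= CodeSeq.decodeK. Qed.

Lemma standard_proj_seq (s : seq nat) i :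
  rel_sem standard (tproj i) (CodeSeq.code s) (nth 0 s i).
Proof.
elim: i s => [|i IH] s; first by rewrite /= /standard /= CodeSeq.codeK -nth0.
exists (CodeSeq.code (behead s)); split; last by rewrite -nth_behead; exact: IH.
by rewrite /= /standard /= CodeSeq.codeK.
Qed.

Lemma standard_proj k (v : k.-tuple nat) (i : 'I_k) :
  rel_sem standard (tproj i) (CodeSeq.code v) (tnth v i).
Proof. by rewrite (tnth_nth 0); exact: standard_proj_seq. Qed.

Lemma standard_section t a n :
  (exists b, rel_sem standard t (cons_code n a) b) -> rel_sem standard (tsection t) a n.
Proof.
case=> b H; exists (cons_code n a); split; first exact: standardQ_cons.
by split; [exact: standardP_cons|exists b].
Qed.

Lemma standard_entry s t x a b :
  rel_sem standard s x a -> rel_sem standard t x b ->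
  rel_sem standard (tentry s t) x (nth 0 (CodeSeq.decode a) b).
Proof.
move=> Hs Ht; exists (cons_code a b); split; last exact: standardE_cons.
split; [exists a|exists b]; split=> //; first exact: standardP_cons.
exact: standardQ_cons.
Qed.

Lemma standard_graph k (f : murec k) (v : k.-tuple nat) r :
  mu_eval f v r -> rel_sem standard (graph_term f) (CodeSeq.code v) r.
Proof.
elim: f v r => {k} [k||k i|k m f IHf g IHg|k f IHf g IHg|k f IHf] v r.
- by move=> /= ->; exists 0; split=> //; apply/standard_zero.
- move=> /= ->; exists (thead v); split; last exact/standard_succ.
  exact: (standard_proj v ord0).
- by move=> ->; exact: standard_proj.
- move=> [w [Hg Hf]]; exists (CodeSeq.code w); split; last exact: IHf.
  apply/rel_sem_foldr_cap => i; exists (tnth w i); split; first by apply: (IHg i); exact: (Hg i).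
  exact: standard_proj.
- move=> [s [Hf Hg ->]].
  set n := thead v in Hg *; set w := [tuple of behead v] in Hf Hg.
  have Ev : (v : seq nat) = n :: w by rewrite (tuple_eta v).
  (* The guessed sequence lists the values at [0] up to [n] inclusive, hence the length [n.+1]. *)
  set q := CodeSeq.code (mkseq s n.+1).
  have Hq m : m <= n -> s m = nth 0 (CodeSeq.decode q) m.
    by move=> Hm; rewrite CodeSeq.codeK nth_mkseq.
  have Ec : CodeSeq.code v = cons_code n (CodeSeq.code w) by rewrite /cons_code CodeSeq.codeK Ev.
  rewrite Ec; set c := cons_code _ _.
  exists (cons_code q c); split; first exact: standardQ_cons.
  split; first split.
  + rewrite Hq //; apply: standard_entry; first exact: standardP_cons.
    by exists c; split; [exact: standardQ_cons|exact: standardP_cons].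
  + exists (s 0); split=> //; split.
      exists (CodeSeq.code w); split; last exact: IHf.
      by exists c; split; exact: standardQ_cons.
    rewrite Hq //; apply: standard_entry; first exact: standardP_cons.
    by exists 0; split=> //; apply/standard_zero.
  (* An index [m] that breaks the step condition would be below [n]; there the element [h], which
     packs [m], [q] and [c], witnesses that the step holds. *)
  + case=> y [[[m [[_ Hm] Hmy]] [c' [Hc' Hy]]] _]; case: Hm.
    have {Hc' Hy} Hmn : m < n.
      move: Hmy Hy Hc'; rewrite /= /standard /= => Hmy Hy Hc'; move: Hmy.
      by rewrite Hy Hc' /c /cons_code !(CodeSeq.codeK, CodeSeq.decodeK).
    apply: (@standard_section (tstep (graph_term g))); set h := cons_code m _.
    have Hd : standard symQ h (cons_code q c) by exact: standardQ_cons.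
    have Hs : rel_sem standard (Comp tQ tP) h q.
      by exists (cons_code q c); split=> //; exact: standardP_cons.
    exists (s m.+1); split; last first.
      rewrite Hq //; apply: standard_entry => //; exists m; split; last exact/standard_succ.
      exact: standardP_cons.
    set zw := CodeSeq.code (s m :: w).
    exists (CodeSeq.code [tuple of m :: s m :: w]); split; last exact/IHg/Hg.
    have -> : CodeSeq.code [tuple of m :: s m :: w] = cons_code m zw.
      by rewrite /cons_code CodeSeq.codeK.
    have Ezw : zw = cons_code (s m) (CodeSeq.code w) by rewrite /cons_code CodeSeq.codeK.
    split; [|split].
    * by exists m; split; exact: standardP_cons.
    * exists (s m); split.
        rewrite Hq 1?ltnW //; apply: standard_entry => //; exact: standardP_cons.
      exists zw; split; first exact: standardQ_cons.
      by rewrite Ezw; exact: standardP_cons.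
    * exists (CodeSeq.code w); split.
        exists (cons_code q c); split=> //; exists c.
        by split; exact: standardQ_cons.
      exists zw; split; first exact: standardQ_cons.
      by rewrite Ezw; exact: standardQ_cons.
- case=> Hr Hlt; have Ec n : cons_code n (CodeSeq.code v) = CodeSeq.code [tuple of n :: v].
    by rewrite /cons_code CodeSeq.codeK.
  split.
    apply: (@standard_section (Comp (graph_term f) tzero)); exists 0, 0.
    split; last exact/standard_zero.
    by rewrite Ec; exact: IHf.
  case=> n [[_ H] Hn]; case: H; have [t Ht] := Hlt n Hn.
  apply: (@standard_section (Comp (graph_term f) (Conv tS))); exists t, t.+1.
  split; last exact/standard_succ.
  by rewrite Ec; exact: IHf.
Qed.

(** * Numerals and soundness of the translation in arbitrary models *)

Fixpoint isnum (dom : Type) (I : 'I_4 -> dom -> dom -> Prop) (n : nat) (x : dom) :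
    Prop :=
  match n with
  | 0 => ~ exists y, rel_sem I tS y x
  | n.+1 => exists2 y, isnum I n y & rel_sem I tS y x
  end.

Section Models.
Variables (dom : Type) (I : 'I_4 -> dom -> dom -> Prop).
Hypothesis I_models : models I.

Let axiom n : n < size axioms -> forall a b,
  rel_sem I (nth (Id, Id) axioms n).1 a b -> rel_sem I (nth (Id, Id) axioms n).2 a b.
Proof.
move=> Hn; apply: I_models; move: n Hn; elim: axioms => [|p s IH] [|n] //=.
  by left.
by move=> Hn; right; apply: IH.
Qed.

Let functionalP a b b' : I symP a b -> I symP a b' -> b = b'.
Proof. by move=> H H'; apply: (axiom (n := 4) isT); exists a. Qed.

Let functionalQ a b b' : I symQ a b -> I symQ a b' -> b = b'.
Proof. by move=> H H'; apply: (axiom (n := 5) isT); exists a. Qed.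

Let functionalE k k' s m z z' : I symP k s -> I symP k' s -> I symQ k m -> I symQ k' m ->
  I symE k z -> I symE k' z' -> z = z'.
Proof.
move=> HP HP' HQ HQ' HE HE'; apply: (axiom (n := 6) isT); exists k; split=> //.
by exists k'; split=> //; split; [exists s|exists m].
Qed.

Let trichotomy a b : a = b \/ I symL a b \/ I symL b a.
Proof. exact: (axiom (n := 2) isT (a := a) (b := b) Logic.I). Qed.

Lemma models_ltS a b c : I symL a b -> rel_sem I tS b c -> I symL a c.
Proof. by move=> H H'; apply: (axiom (n := 1) isT); exists b. Qed.

Lemma models_succ_total a : exists b, rel_sem I tS a b.
Proof. by have [b [H _]] := axiom (n := 3) isT (erefl a); exists b. Qed.

(** By trichotomy, one of two distinct successors would lie between [a] and the other, which would
    then not be immediate. *)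
Lemma models_succ_functional a b b' :
  rel_sem I tS a b -> rel_sem I tS a b' -> b = b'.
Proof.
move=> [H1 H2] [H3 H4]; have [//|[H|H]] := trichotomy b b'.
  by case: H4; exists b.
by case: H2; exists b'.
Qed.

Lemma models_succ_injective a a' b :
  rel_sem I tS a b -> rel_sem I tS a' b -> a = a'.
Proof.
move=> [H1 H2] [H3 H4]; have [//|[H|H]] := trichotomy a a'.
  by case: H2; exists a'.
by case: H4; exists a.
Qed.

Lemma models_lt_cases a b : I symL a b ->
  exists c, (a = c \/ I symL a c) /\ rel_sem I tS c b.
Proof. exact: (axiom (n := 0) isT). Qed.

(** For zero: by the first axiom, the larger of two comparable elements has an immediate
    predecessor. *)
Lemma isnum_unique n x y : isnum I n x -> isnum I n y -> x = y.
Proof.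
elim: n x y => [|n IH] x y /=.
  move=> Hx Hy; have [//|[H|H]] := trichotomy x y.
    by case: Hy; have [c [_ Hc]] := models_lt_cases H; exists c.
  by case: Hx; have [c [_ Hc]] := models_lt_cases H; exists c.
move=> [x' Hx' Hx] [y' Hy' Hy]; rewrite -(IH _ _ Hx' Hy') in Hy.
exact: models_succ_functional Hx Hy.
Qed.

Lemma isnum_exists n z : isnum I 0 z -> exists x, isnum I n x.
Proof.
move=> Hz; elim: n => [|n [x Hx]]; first by exists z.
by have [y Hy] := models_succ_total x; exists y, x.
Qed.

Lemma isnum_lt m n x y : isnum I m x -> isnum I n y -> m < n -> I symL x y.
Proof.
move=> Hx; elim: n y => [//|n IH] y [y' Hy' Hy].
rewrite ltnS leq_eqVlt => /orP[/eqP E|Hmn].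
  by rewrite E in Hx; rewrite (isnum_unique Hx Hy'); case: Hy.
exact: models_ltS (IH _ Hy' Hmn) Hy.
Qed.

(** The first axiom descends to the immediate predecessor of [y], which is unique. Hence nothing
    nonstandard lies below a numeral. *)
Lemma lt_isnum n x y : isnum I n y -> I symL x y -> exists2 m, m < n & isnum I m x.
Proof.
elim: n y => [|n IH] y Hy /models_lt_cases[c [Hc Hcy]].
  by case: Hy; exists c.
have [y' Hy' Hyy] := Hy; have E := models_succ_injective Hyy Hcy; subst y'.
case: Hc => [->|/(IH _ Hy')[m Hm Hx]]; first by exists n.
by exists m => //; exact: ltnW.
Qed.

Lemma isnum_tzero x y : rel_sem I tzero x y <-> x = y /\ isnum I 0 x.
Proof.
split=> [[H1 H2]|[<- H]]; split=> // -[z Hz]; apply: H2 || apply: H.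
  by exists z; rewrite -?H1.
by case: Hz => _ Hz; exists z.
Qed.

Lemma not_isnum_succ0 n x : isnum I n.+1 x -> ~ isnum I 0 x.
Proof. by move=> [y _ Hy]; apply; exists y. Qed.

(** Constrains only those projections that exist. This suffices because soundness merely limits the
    possible outputs of a term. *)
Definition codes (c : dom) (s : seq nat) :=
  forall i x, i < size s -> rel_sem I (tproj i) c x -> isnum I (nth 0 s i) x.

Lemma codes_cons e n s : (forall x, I symP e x -> isnum I n x) ->
  (forall c, I symQ e c -> codes c s) -> codes e (n :: s).
Proof.
move=> HP HQ [|i] x /= Hi; first exact: HP.
by case=> c [Hc Hx]; exact: HQ Hc _ _ Hi Hx.
Qed.

Lemma codes_behead e c n s : codes e (n :: s) -> I symQ e c -> codes c s.
Proof. by move=> He Hc i x Hi Hx; apply: (He i.+1) => //; exists c. Qed.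

Lemma codes_section e c n x s :
  codes c s -> isnum I n x -> I symQ e c -> I symP e x -> codes e (n :: s).
Proof.
move=> Hc Hx HQ HP; apply: codes_cons => [y /(functionalP HP) <- //|d].
by move=> /(functionalQ HQ) <-.
Qed.

Lemma entry_unique s t c d a b z z' :
  rel_sem I (tentry s t) c z -> I symP d a -> I symQ d b -> I symE d z' ->
  (forall x, rel_sem I s c x -> x = a) -> (forall x, rel_sem I t c x -> x = b) ->
  z = z'.
Proof.
move=> [k [[[x [Hx HP]] [y [Hy HQ]]] HE]] HPd HQd HEd Hs Ht.
rewrite (Hs _ Hx) in HP; rewrite (Ht _ Hy) in HQ.
exact: functionalE HP HPd HQ HQd HE HEd.
Qed.

(** Induction on [f]. The guessed sequence of a primitive recursion may be arbitrary beyond [n], but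
    its entries up to [n] are forced one after another. For minimization, the output is compared
    with the numeral [r]. *)
Lemma graph_term_sound k (f : murec k) (v : k.-tuple nat) r c y :
  mu_eval f v r -> codes c v -> rel_sem I (graph_term f) c y -> isnum I r y.
Proof.
elim: f v r c y => {k} [k||k i|k m f IHf g IHg|k f IHf g IHg|k f IHf] v r c y.
- by move=> /= -> _ [z [_ /isnum_tzero[<-]]].
- move=> /= -> Hc [z [Hz Hy]]; exists z => //.
  have -> : thead v = nth 0 v 0 by rewrite /thead (tnth_nth 0).
  by apply: Hc; rewrite ?size_tuple.
- by move=> /= -> Hc Hy; rewrite (tnth_nth 0); apply: Hc Hy; rewrite size_tuple ltn_ord.
- move=> [w [Hg Hf]] Hc [d [/rel_sem_foldr_cap Hd Hy]].
  apply: IHf Hf _ Hy => i x; rewrite size_tuple => Hi Hx.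
  have [x' [Hx' Hdx']] := Hd (Ordinal Hi).
  have := IHg _ _ _ _ _ (Hg (Ordinal Hi)) Hc Hx'.
  rewrite (tnth_nth 0) /=; suff -> : x = x' by [].
  move: Hx Hdx'; rewrite /=; move: (i); clear -functionalP functionalQ => i.
  elim: i d => [|i IH] d; first exact: functionalP.
  move=> [e [He Hx]] [e' [He' Hx']]; rewrite -(functionalQ He He') in Hx'.
  exact: IH Hx Hx'.
- move=> [s [Hf Hg ->]].
  set n := thead v in Hg *; set w := [tuple of behead v] in Hf Hg.
  have Ev : (v : seq nat) = n :: w by rewrite (tuple_eta v).
  rewrite Ev => Hc [d [Hdc [[Hy [z1 [[Hz1 Hz0] _]]] Hstep]]].
  case: Hy => k0 [[[sg [Hdsg Hk0sg]] [a0 [[c0 [Hdc0 Hc0a0]] Hk0a0]]] Hk0y].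
  rewrite -(functionalQ Hdc Hdc0) {c0 Hdc0} in Hc0a0.
  have Ha0 : isnum I n a0 by apply: (Hc 0).
  (* The claim covers every [k] with projections [sg] and [a], since each lookup in the term chooses
     its own pair element. *)
  suff H m : m <= n -> forall k a z, isnum I m a -> I symP k sg -> I symQ k a ->
      I symE k z -> isnum I (s m) z.
    exact: H Ha0 Hk0sg Hk0a0 Hk0y.
  elim: m => [|m IH] Hmn k1 a z Ha Hk1 Hk1a Hk1z.
    have <- : z1 = z.
      apply: (@entry_unique tP (Comp Top tzero) _ _ _ _ _ _ Hz0 Hk1 Hk1a Hk1z) => x.
        by move/functionalP; apply.
      by case=> _ [_ /isnum_tzero[-> H0]]; apply: isnum_unique Ha.
    case: Hz1 => u [[c' [Hdc' Hcu]] Hz1]; apply: IHf Hf _ Hz1.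
    by rewrite -(functionalQ Hdc Hdc') in Hcu; apply: codes_behead Hc Hcu.
  case: Ha => b Hb Hba.
  have [h [Hhd [Hhb [y1 [[[e [[HeP [HeE HeQ]] Hgy]] Hy] _]]]]] :
      rel_sem I (tsection (tstep (graph_term g))) d b.
    (* Otherwise [b], which is below [a0] because [m < n], would be an excluded counterexample to
       the step condition. *)
    apply: NNPP => Hnot; apply: Hstep; exists a0; split=> //; split; last by exists c.
    by exists b; split=> //; exact: isnum_lt Hb Ha0 Hmn.
  have Hsg x : rel_sem I (Comp tQ tP) h x -> x = sg.
    case=> d' [Hhd' Hd'x]; rewrite -(functionalQ Hhd Hhd') in Hd'x.
    exact: functionalP Hd'x Hdsg.
  have <- : y1 = z.
    apply: (@entry_unique (Comp tQ tP) (Comp tP tS) _ _ _ _ _ _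
              Hy Hk1 Hk1a Hk1z Hsg) => x [b' [Hhb' Hb'x]].
    rewrite -(functionalP Hhb Hhb') in Hb'x.
    exact: models_succ_functional Hb'x Hba.
  apply: IHg (Hg m Hmn) _ Hgy; apply: codes_cons => [x Hx|q Heq].
    case: HeP => b' [Hhb' Heb']; rewrite (functionalP Hx Heb').
    by rewrite -(functionalP Hhb Hhb').
  case: HeE => zm [Hzm [q' [Heq' Hq'z]]]; case: HeQ => u [Hu [q'' [Heq'' Hq''u]]].
  rewrite -(functionalQ Heq Heq') in Hq'z; rewrite -(functionalQ Heq Heq'') in Hq''u.
  apply: codes_section _ _ Hq''u Hq'z.
    case: Hu => d' [Hd' [c' [Hc' Hu]]]; rewrite -(functionalQ Hhd Hd') in Hc'.
    by rewrite -(functionalQ Hdc Hc') in Hu; apply: codes_behead Hc Hu.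
  case: Hzm => k2 [[[sg' [/Hsg -> Hk2]] [b' [Hhb' Hk2b]]] Hk2z].
  rewrite -(functionalP Hhb Hhb') in Hk2b.
  exact: IH (ltnW Hmn) _ _ _ Hb Hk2 Hk2b Hk2z.
- case=> Hr Hlt Hc [[e [HQ [HP [z [[z' [Hz /isnum_tzero[_ Hz0]]] _]]]]] Hmin].
  (* The zero from which the numeral [r] is built is the value that the term requires of [f] at
     [y]. *)
  have [x Hx] := isnum_exists r Hz0.
  have [E|[Hyx|Hxy]] := trichotomy y x; first by rewrite E.
    have [i Hi Hiy] := lt_isnum Hx Hyx.
    have [t Ht] := Hlt i Hi.
    have := IHf _ _ _ _ Ht (codes_section Hc Hiy HQ HP) Hz.
    by move=> /not_isnum_succ0.
  (* If [x] were below [y], the term would require a successor as value of [f] at [x], where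
     soundness allows only zero. *)
  case: Hmin; exists x; split=> //; split=> // -[e' [HQ' [HP' [t [[y' [Hy' Hty]] _]]]]].
  have := IHf _ _ _ _ Hr (codes_section Hc Hx HQ' HP') Hy'.
  by case; exists t.
Qed.

End Models.

(** * The expression attached to a function and an argument *)

Fixpoint numeral_term (n : nat) : rel_term 'I_4 :=
  match n with
  | 0 => Comp tzero Top
  | n.+1 => Comp (Conv tS) (numeral_term n)
  end.

Lemma numeral_termP (dom : Type) (I : 'I_4 -> dom -> dom -> Prop) n x y :
  rel_sem I (numeral_term n) x y <-> isnum I n x.
Proof.
elim: n x => [|n IH] x /=.
  split=> [[z [/isnum_tzero[_ H] _]]|H]; first exact: H.
  by exists x; split=> //; apply/isnum_tzero.
by split=> [[z [Hz /IH Hn]]|[z /IH Hn Hz]]; exists z.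
Qed.

(* Relates [zero] to [k] when the axioms hold and [f] sends some list with head
   [k] to zero. *)
Definition zero_value_term (f : murec 1) : rel_term 'I_4 :=
  Diff (Comp tzero
          (Comp Top (Cap (Comp (graph_term f) (Comp tzero Top)) tP)))
       (Comp Top (Comp violation Top)).

Definition sentence (f : murec 1) (n : nat) : rel_term 'I_4 :=
  Comp (zero_value_term f) (numeral_term n).

Lemma sentence_standard (f : murec 1) n x y :
  mu_eval f [tuple n] 0 -> rel_sem standard (sentence f n) x y <-> x = 0.
Proof.
move=> Hf; split=> [[z [[[u [/standard_zero[-> _] _]] _] _]] //|->].
exists n; split; last first.
  apply/numeral_termP; elim: n {Hf} => [|n IH] /=; last by exists n => //; apply/standard_succ.
  by case=> z /standard_succ.
split=> [|[z [_ [z' [Hz' _]]]]]; last first.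
  by apply: (proj1 (violationP _) standard_models); exists z, z'.
exists 0; split; first exact/standard_zero.
exists (CodeSeq.code [tuple n]); split=> //; split; last exact: (standard_proj_seq [:: n] 0).
exists 0; split; first exact: standard_graph.
by exists 0; split=> //; apply/standard_zero.
Qed.

(** A related pair would make [I] a model and give a list whose head is the numeral [n] and which
    the graph term sends to zero, whereas soundness forces the numeral one. *)
Lemma sentence_unsat (dom : Type) (I : 'I_4 -> dom -> dom -> Prop) (f : murec 1) n x y :
  mu_eval f [tuple n] 1 -> ~ rel_sem I (sentence f n) x y.
Proof.
move=> Hf [k [[[z [_ [c [_ [[z1 [Hfc [z2 [Hz1 _]]]] Hck]]]]] Hmod] /numeral_termP Hk]].
have I_models : models I.
  apply/violationP => -[a [b Hab]]; apply: Hmod.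
  by exists a; split=> //; exists b.
have Hc : codes I c [tuple n].
  move=> [|i] // w _ Hw; suff <- : k = w by [].
  by apply: (I_models (Comp (Conv tP) tP, Id)); [do 4 right; left|exists c].
have [_ H0] := proj1 (isnum_tzero _ _ _) Hz1.
exact: not_isnum_succ0 (graph_term_sound I_models Hf Hc Hfc) H0.
Qed.

(** * Computability of the coding of expressions *)

Definition computable k (F : k.-tuple nat -> nat) :=
  exists f : murec k, forall v, mu_eval f v (F v).

Lemma mu_eval_comp1 k (f : murec 1) (g : murec k) v m r :
  mu_eval g v m -> mu_eval f [tuple m] r -> mu_eval (MComp f (fun _ : 'I_1 => g)) v r.
Proof. by move=> Hg Hf; exists [tuple m]; split=> // i; rewrite ord1. Qed.

Lemma computable_proj k (i : 'I_k) : computable (fun v => tnth v i).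
Proof. by exists (MProj i). Qed.

Lemma computable_comp k m (F : m.-tuple nat -> nat) (G : 'I_m -> k.-tuple nat -> nat) :
  computable F -> (forall i, computable (G i)) ->
  computable (fun v => F [tuple G i v | i < m]).
Proof.
move=> [f Hf] /fin_all_exists[g Hg]; exists (MComp f g) => v.
exists [tuple G i v | i < m]; split=> [i|]; last exact: Hf.
by rewrite tnth_mktuple; exact: Hg.
Qed.

Lemma computable_succ k (F : k.-tuple nat -> nat) :
  computable F -> computable (fun v => (F v).+1).
Proof.
move=> HF; have HS : computable (fun v : 1.-tuple nat => (tnth v ord0).+1).
  by exists MSucc.
have [f Hf] := computable_comp HS (fun=> HF); exists f => v.
by have := Hf v; rewrite tnth_mktuple.
Qed.

Lemma computable_const k n : computable (fun _ : k.-tuple nat => n).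
Proof.
elim: n => [|n IH]; first by exists (MZero k).
exact: computable_succ IH.
Qed.

Lemma computable_rec k (F : k.-tuple nat -> nat) (G : k.+2.-tuple nat -> nat)
    (R : nat -> k.-tuple nat -> nat) :
  computable F -> computable G ->
  (forall v, R 0 v = F v) ->
  (forall n v, R n.+1 v = G [tuple of n :: R n v :: v]) ->
  computable (fun v : k.+1.-tuple nat => R (thead v) [tuple of behead v]).
Proof.
move=> [f Hf] [g Hg] R0 RS; exists (MPrec f g) => v.
exists (fun n => R n [tuple of behead v]); split=> // [|n _]; rewrite ?R0 ?RS.
  exact: Hf.
exact: Hg.
Qed.

Definition computable2 (op : nat -> nat -> nat) :=
  computable (fun v : 2.-tuple nat => op (tnth v ord0) (tnth v ord_max)).

Lemma computable_comp2 k op (F G : k.-tuple nat -> nat) :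
  computable2 op -> computable F -> computable G ->
  computable (fun v => op (F v) (G v)).
Proof.
move=> Hop HF HG.
pose H (i : 'I_2) := if i == ord0 then F else G.
have HH i : computable (H i) by rewrite /H; case: ifP.
have [f Hf] := computable_comp Hop HH; exists f => v.
by have := Hf v; rewrite !tnth_mktuple.
Qed.

Lemma computable2_rec (op : nat -> nat -> nat) (G : nat -> nat -> nat) :
  computable (fun v : 1.-tuple nat => op 0 (tnth v ord0)) -> computable2 G ->
  (forall n m, op n.+1 m = G (op n m) m) -> computable2 op.
Proof.
move=> H0 HG opS.
pose R n (v : 1.-tuple nat) := op n (tnth v ord0).
have HG3 : computable (fun v : 3.-tuple nat =>
    (* Position 0 holds the recursion index; the previous value and the parameter follow. *)
    G (tnth v (inord 1)) (tnth v (inord 2))).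
  by apply: computable_comp2 => //; exact: computable_proj.
have [f Hf] := @computable_rec 1 _ _ R H0 HG3 (fun=> erefl)
  (fun n v => ltac:(rewrite /R opS !(tnth_nth 0) !inordK //=)).
exists f => v; have := Hf v; rewrite /R /thead !(tnth_nth 0) /= nth_behead.
exact.
Qed.

Lemma computable2_add : computable2 addn.
Proof.
apply: (@computable2_rec _ (fun a _ => a.+1)) => [||//].
  exact: computable_proj.
exact/computable_succ/computable_proj.
Qed.

Lemma computable2_mul : computable2 muln.
Proof.
apply: (@computable2_rec _ (fun a b => b + a)) => [||//].
  exact: computable_const.
exact: (computable_comp2 computable2_add (computable_proj _) (computable_proj _)).
Qed.

Lemma computable_pow k (F : k.-tuple nat -> nat) :
  computable F -> computable (fun v => 2 ^ F v).
Proof.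
move=> HF; have Hpow : computable2 (fun n _ => 2 ^ n).
  apply: (@computable2_rec _ (fun a _ => a + a)) => [||n _].
  - exact: computable_const.
  - exact: (computable_comp2 computable2_add (computable_proj _) (computable_proj _)).
  - by rewrite expnS mul2n addnn.
exact: (computable_comp2 Hpow HF HF).
Qed.

Lemma computable_code_nil k :
  computable (fun _ : k.-tuple nat => CodeSeq.code [::]).
Proof. exact: computable_const. Qed.

(** The code of [n :: s] is [2 ^ n] times the successor of twice the code of [s]. *)
Lemma computable_code_cons k (F : k.-tuple nat -> nat) (s : k.-tuple nat -> seq nat) :
  computable F -> computable (fun v => CodeSeq.code (s v)) ->
  computable (fun v => CodeSeq.code (F v :: s v)).
Proof.
move=> HF Hs.
have H2 : computable (fun v => (CodeSeq.code (s v) + CodeSeq.code (s v)).+1).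
  by apply/computable_succ/computable_comp2 => //; exact: computable2_add.
have [f Hf] := computable_comp2 computable2_mul (computable_pow HF) H2.
by exists f => v; have := Hf v; rewrite /= addnn.
Qed.

(** The shape of an instance code on the diagonal: the argument is both the code of the first factor
    and the number of successor steps in the second. *)
Lemma computable_code_iter a b t u c :
  computable (fun v : 1.-tuple nat => CodeSeq.code [:: a; b;
    CodeSeq.code [:: t; tnth v ord0;
      iter (tnth v ord0) (fun z => CodeSeq.code [:: t; u; z]) c]]).
Proof.
have Hcons k (F G : k.-tuple nat -> nat) : computable F -> computable G ->
    computable (fun v => CodeSeq.code [:: t; F v; G v]).
  move=> HF HG; apply: (@computable_code_cons k (fun=> t)).
    exact: computable_const.
  apply: computable_code_cons => //; apply: (@computable_code_cons k G) => //.
  exact: computable_code_nil.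
pose R n (_ : 0.-tuple nat) := iter n (fun z => CodeSeq.code [:: t; u; z]) c.
have HR : computable (fun v : 1.-tuple nat => R (tnth v ord0) [tuple of behead v]).
  apply: (@computable_rec 0 (fun=> c)
    (fun v => CodeSeq.code [:: t; u; tnth v ord_max])) => //.
    exact: computable_const.
  by apply: Hcons; [exact: computable_const|exact: computable_proj].
apply: (@computable_code_cons 1 (fun=> a)); first exact: computable_const.
apply: (@computable_code_cons 1 (fun=> b)); first exact: computable_const.
apply: (@computable_code_cons 1 _ (fun=> [::])); last exact: computable_code_nil.
by apply: Hcons; [exact: computable_proj|exact: HR].
Qed.

(** * The reduction and the diagonal argument *)

Definition binary_voc : fin_voc := @FinVoc (nseq 4 (2, 1)) isT isT.

Lemma binary_ar M : @ar (voc_of_fin binary_voc) M = 2.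
Proof. by case: M => -[|[|[|[|]]]]. Qed.

Lemma binary_iar M : @iar (voc_of_fin binary_voc) M = 1.
Proof. by case: M => -[|[|[|[|]]]]. Qed.

Lemma diag_interp_surj (dom : Type) (J : 'I_4 -> dom -> dom -> Prop) :
  exists D : interpretation (voc_of_fin binary_voc) dom, diag_interp D = J.
Proof.
exists (fun M t => exists a b, J M a b /\ tval t = [:: a; b]).
apply: functional_extensionality => M; apply: functional_extensionality => a.
apply: functional_extensionality => b; apply: propositional_extensionality.
rewrite /diag_interp val_tcast /=.
have -> : nseq (iar M) a ++ nseq (ar M - iar M) b = [:: a; b].
  by rewrite binary_ar binary_iar.
by split=> [[a' [b' [H [-> ->]]]]|H] //; exists a, b.
Qed.

Section Reduction.
Variables (V : countType) (x0 : V).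

Local Notation lif_term := (@lif_of (voc_of_fin binary_voc) V x0).

Lemma lif_code_comp (F : fin_voc) (a b : lif (voc_of_fin F) V) :
  lif_code (LComp a b) = CodeSeq.code [:: 5; lif_code a; lif_code b].
Proof. by []. Qed.

Definition sentence_instance (f : murec 1) (n : nat) : membership_instance V :=
  @MembershipInstance V binary_voc x0 (lif_term (sentence f n)).

Lemma sentence_instance_zero (dom : Type) (f : murec 1) n :
  (exists h : nat -> dom, bijective h) -> mu_eval f [tuple n] 0 ->
  sem_input_membership dom (sentence_instance f n).
Proof.
move=> [h [h' hK h'K]] Hf.
have [D HD] := diag_interp_surj (fun i a b => standard i (h' a) (h' b)).
have arity (M : mname (voc_of_fin binary_voc)) : iar M < ar M.
  by rewrite binary_ar binary_iar.
have semE nu1 nu2 : sem (lif_term (sentence f n)) D nu1 nu2 <->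
    agree_on (fun y => y <> x0) nu1 nu2 /\ h' (nu1 x0) = 0.
  apply: (iff_trans (sem_lif_of x0 _ D nu1 nu2 arity)); rewrite HD.
  by rewrite (rel_sem_transport _ hK h'K) (sentence_standard _ _ Hf).
(* Changing [x0] from [h 0] to [h 1] leaves the domain of the expression, so no output valuation
   exists at all. *)
move=> /(_ D (fun=> h 0) (fun=> h 0) (fun y => if y == x0 then h 1 else h 0)).
case.
- by apply/semE; rewrite hK.
- by move=> y /eqP/negPf /= ->.
- by move=> nu2 [_ /semE[_]]; rewrite eqxx hK.
Qed.

(** The semantics is empty, so determination holds vacuously. *)
Lemma sentence_instance_one (dom : Type) (f : murec 1) n :
  mu_eval f [tuple n] 1 -> ~ sem_input_membership dom (sentence_instance f n).
Proof.
move=> Hf; apply => D nu1 nu2 nu1' H; exfalso.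
have arity (M : mname (voc_of_fin binary_voc)) : iar M < ar M.
  by rewrite binary_ar binary_iar.
have [_ Hrel] :=
  proj1 (@sem_lif_of (voc_of_fin binary_voc) V dom x0 (sentence f n) D nu1 nu2 arity) H.
exact: sentence_unsat Hf Hrel.
Qed.

Definition instance_code (e n : nat) :=
  CodeSeq.code [:: fv_code binary_voc; choice.pickle x0;
    CodeSeq.code [:: 5; e; @lif_code binary_voc V (lif_term (numeral_term n))]].

Lemma sentence_instance_code f n :
  mi_code (sentence_instance f n) =
  instance_code (@lif_code binary_voc V (lif_term (zero_value_term f))) n.
Proof.
exact: (congr1 (fun z => CodeSeq.code [:: fv_code binary_voc; choice.pickle x0; z])
  (lif_code_comp (lif_term (zero_value_term f)) (lif_term (numeral_term n)))).
Qed.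

Lemma lif_code_numeral n :
  @lif_code binary_voc V (lif_term (numeral_term n)) =
  iter n (fun z => CodeSeq.code [:: 5; @lif_code binary_voc V (lif_term (Conv tS)); z])
         (@lif_code binary_voc V (lif_term (numeral_term 0))).
Proof.
by elim: n => // n IH; rewrite iterS -IH; apply: lif_code_comp.
Qed.

Lemma computable_instance_code :
  computable (fun v : 1.-tuple nat => instance_code (tnth v ord0) (tnth v ord0)).
Proof.
have [f Hf] := computable_code_iter (fv_code binary_voc) (choice.pickle x0) 5
  (@lif_code binary_voc V (lif_term (Conv tS)))
  (@lif_code binary_voc V (lif_term (numeral_term 0))).
by exists f => v; rewrite /instance_code lif_code_numeral; exact: Hf.
Qed.

End Reduction.

Theorem proposition3p17 (dom : Type)
    (hdom : exists f : nat -> dom, bijective f) (V : countType) (x0 : V) :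
  undecidable_problem (@mi_code V) (@sem_input_membership dom V).
Proof.
move=> [c Hc]; have [h Hh] : exists h : murec 1,
    forall n, mu_eval h [tuple n] (instance_code x0 n n).
  by have [h Hh] := computable_instance_code x0; exists h => n; exact: Hh.
(* At [e], the code of its own first factor, [f] returns the verdict of [c] on the instance built
   from [f] and [e]. *)
pose f := MComp c (fun _ : 'I_1 => h).
pose e := @lif_code binary_voc V
  (@lif_of (voc_of_fin binary_voc) V x0 (zero_value_term f)).
have Hf r : mu_eval c [tuple mi_code (sentence_instance x0 f e)] r ->
    mu_eval f [tuple e] r.
  rewrite sentence_instance_code; exact: mu_eval_comp1 (Hh e).
have [H1 H0] := Hc (sentence_instance x0 f e).
(* Membership would yield the value 1 and thereby empty semantics; non-membership yields the value 0
   and thereby membership. *)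
have Hno : ~ sem_input_membership dom (sentence_instance x0 f e).
  by move=> Hyes; apply: (sentence_instance_one (Hf _ (H1 Hyes))) Hyes.
exact: Hno (sentence_instance_zero hdom (Hf _ (H0 Hno))).
Qed.
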